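(* Let $\tau>0$, $M\ge0$, and let discrete closed surfaces $\Gamma_h^m=\boldsymbol Y_h^m(\widehat\Gamma_h)$ of degree $\ell\ge1$ be generated from a given $\boldsymbol Y_h^0$ as follows: for each $m=0,\dots,M$, the surface $\Gamma_h^m$ satisfies ($\mathcal B1$): $|\mathcal J(\boldsymbol Y_h^m)|>0$ on each $\widehat\sigma_j$, $j=1,\dots,J$; the pair $(\boldsymbol X_h^{m+1},H_h^{m+1})\in[\mathbb W_\ell^m]^3\times\mathbb W_\ell^m$ is a solution of $$\Big(\frac{\boldsymbol X_h^{m+1}-\mathrm{id}}{\tau},\varphi_h\boldsymbol n_h^m\Big)_{\Gamma_h^m}=\begin{cases}(H_h^{m+1},\varphi_h)_{\Gamma_h^m}, & \text{MCF},\\ (\nabla_{\Gamma_h^m}H_h^{m+1},\nabla_{\Gamma_h^m}\varphi_h)_{\Gamma_h^m}, & \text{SD},\end{cases}$$ $$(H_h^{m+1}\boldsymbol n_h^m,\boldsymbol\eta_h)_{\Gamma_h^m}+(\nabla_{\Gamma_h^m}\boldsymbol X_h^{m+1},\nabla_{\Gamma_h^m}\boldsymbol\eta_h)_{\Gamma_h^m}=0$$ for all $\varphi_h\in\mathbb W_\ell^m$, $\boldsymbol\eta_h\in[\mathbb W_\ell^m]^3$ (with the same choice, MCF or SD, for all $m$); and $\boldsymbol Y_h^{m+1}=\boldsymbol X_h^{m+1}\circ\boldsymbol Y_h^m$. Then $$\mathcal H^2(\Gamma_h^{M+1})\le\mathcal H^2(\Gamma_h^0)-\begin{cases}\tau\sum_{m=0}^M(H_h^{m+1},H_h^{m+1})_{\Gamma_h^m},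 & \text{MCF},\\ \tau\sum_{m=0}^M(\nabla_{\Gamma_h^m}H_h^{m+1},\nabla_{\Gamma_h^m}H_h^{m+1})_{\Gamma_h^m}, & \text{SD},\end{cases}$$ where $\mathcal H^2(\Gamma_h^m)=\int_{\Gamma_h^m}\mathrm ds=\int_{\widehat\Gamma_h}|\mathcal J(\boldsymbol Y_h^m)|\,\mathrm ds$.
   Context: Reference grid. $\widehat{\mathbb K}\subset\mathbb R^2$ is the standard 2-simplex; $\widehat\Gamma_h=\bigcup_{j=1}^J\widehat\sigma_j\subset\mathbb R^3$ is a closed oriented polyhedral surface, conformingly triangulated by flat triangles $\widehat\sigma_j=A_j(\widehat{\mathbb K})$, $A_j$ injective affine maps. On $\widehat\sigma_j$, $\{\widehat{\boldsymbol\tau}_1,\widehat{\boldsymbol\tau}_2\}$ is an orthonormal basis of the tangent space, compatible with the orientation. $\mathbb P^\ell$ denotes polynomials of degree $\le\ell$. Discrete surface. $\boldsymbol Y_h^m:\widehat\Gamma_h\to\mathbb R^3$ is continuous with $\boldsymbol Y_h^m|_{\widehat\sigma_j}\in[\mathbb P^\ell(\widehat\sigma_j)]^3$, and $\Gamma_h^m=\boldsymbol Y_h^m(\widehat\Gamma_h)$. Functions on $\Gamma_h^m$ are identified with their pull-backs under $\boldsymbol Y_h^m$ to $\widehat\Gamma_h$. The finite element space is $$\mathbb W_\ell^m=\{v_h\in H^1(\Gamma_h^m): v_h\circ\boldsymbol Y_h^m|_{\widehat\sigma_j}\in\mathbb P^\ell(\widehat\sigma_j),\ j=1,\dots,J\},$$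 i.e. the functions whose pull-back is continuous on $\widehat\Gamma_h$ and polynomial of degree $\le\ell$ on each triangle. $\mathrm{id}$ is the identity on $\Gamma_h^m$ (pull-back $\boldsymbol Y_h^m$). Geometry. $\mathcal J(\boldsymbol Y_h^m)=\partial_{\widehat{\boldsymbol\tau}_1}\boldsymbol Y_h^m\times\partial_{\widehat{\boldsymbol\tau}_2}\boldsymbol Y_h^m$ on $\widehat\sigma_j$, and $\boldsymbol n_h^m\circ\boldsymbol Y_h^m=\mathcal J(\boldsymbol Y_h^m)/|\mathcal J(\boldsymbol Y_h^m)|$ piecewise (orientations chosen so that it is the outer unit normal). $\nabla_{\Gamma_h^m}$ is the piecewise surface gradient on $\Gamma_h^m$: $\nabla_{\Gamma_h^m}f=\sum_{k=1}^2(\partial_{\boldsymbol\tau_k}f)\,\boldsymbol\tau_k$ (for vector-valued $f$: $\sum_k\partial_{\boldsymbol\tau_k}f\otimes\boldsymbol\tau_k$), with $\{\boldsymbol\tau_1,\boldsymbol\tau_2\}$ an orthonormal basis of the tangent space of the curved element, i.e. of the range of the derivative of $\boldsymbol Y_h^m|_{\widehat\sigma_j}$. Inner product. $(u,v)_{\Gamma_h^m}=\int_{\widehat\Gamma_h}(u\circ\boldsymbol Y_h^m)\cdot(v\circ\boldsymbol Y_h^m)|\mathcal J(\boldsymbol Y_h^m)|\,\mathrm ds$ (product, Euclidean or Frobenius inner product for scalars, vectors, matrices). MCF = mean curvature flow, SD = surface diffusion. *)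

(* Defs.v *)
(* Multivariate polynomials come from multinomials, imported without its notations
   because they clash with those of mathcomp-analysis. *)
From HB Require Import structures.
From mathcomp Require Import all_boot all_order all_algebra.
From mathcomp Require Import all_classical all_reals all_analysis.
From mathcomp Require Import -(notations) mpoly.

Set Implicit Arguments.
Unset Strict Implicit.
Unset Printing Implicit Defensive.

Import Order.TTheory GRing.Theory Num.Theory.
Import numFieldNormedType.Exports.
Local Open Scope classical_set_scope.
Local Open Scope ring_scope.

Section EuclideanSpace.
Variable R : realType.

(* The Frobenius inner product; on row vectors, the Euclidean one. *)
Definition inner (p q : nat) (A B : 'M[R]_(p, q)) : R :=
  \sum_(i < p) \sum_(j < q) A i j * B i j.

(* The library's norm on matrices is the sup norm, hence this definition. *)
Definition enorm (p q : nat) (A : 'M[R]_(p, q)) : R := Num.sqrt (inner A A).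

(* Indices are taken in 'I_3 = Z/3. *)
Definition cross (u v : 'rV[R]_3) : 'rV[R]_3 :=
  \row_(k < 3) (u 0 (k + 1) * v 0 (k + 2%:R) - u 0 (k + 2%:R) * v 0 (k + 1)).

Definition tensor (u v : 'rV[R]_3) : 'M[R]_3 := u^T *m v.

Definition segment3 (a b : 'rV[R]_3) : set 'rV[R]_3 :=
  [set p | exists2 t : R, 0 <= t <= 1 & p = (1 - t) *: a + t *: b].

(* The rows of T form an orthonormal basis of the row space of B. *)
Definition orthonormal_basis (T B : 'M[R]_(2, 3)) : Prop :=
  T *m T^T = 1%:M /\ (T == B)%MS.

Definition ref_triangle : set (R * R) :=
  [set x | 0 <= x.1 /\ 0 <= x.2 /\ x.1 + x.2 <= 1].

Definition ref_vertex (a : 'I_3) : R * R := ((a == 1)%:R, (a == 2%:R)%:R).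

End EuclideanSpace.

(* The j-th affine map is x |-> base j + x.1 * row 0 (lin j) + x.2 * row 1 (lin j),
   and the rows of frame j are the tangent vectors tau_1, tau_2. *)
Record grid (R : realType) := Grid {
  ntri : nat;
  base : 'I_ntri -> 'rV[R]_3;
  lin : 'I_ntri -> 'M[R]_(2, 3);
  frame : 'I_ntri -> 'M[R]_(2, 3)
}.

Section ReferenceGrid.
Variables (R : realType) (g : grid R).
Implicit Types i j : 'I_(ntri g).

Definition amap j (x : R * R) : 'rV[R]_3 :=
  base j + x.1 *: row 0 (lin j) + x.2 *: row 1 (lin j).

Definition triangle j : set 'rV[R]_3 := amap j @` @ref_triangle R.

Definition vertex j (a : 'I_3) : 'rV[R]_3 := amap j (ref_vertex R a).

Definition polyhedron : set 'rV[R]_3 := \bigcup_(j in [set: 'I_(ntri g)]) triangle j.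

Definition ref_normal j : 'rV[R]_3 := cross (row 0 (frame j)) (row 1 (frame j)).

(* Distinct triangles are disjoint or meet in a common vertex or edge. *)
Definition conforming : Prop := forall i j, i != j ->
  [\/ triangle i `&` triangle j = set0,
      exists a b, vertex i a = vertex j b /\
        triangle i `&` triangle j = [set vertex i a]
    | exists a a' b b',
        [/\ a != a', vertex i a = vertex j b, vertex i a' = vertex j b' &
            triangle i `&` triangle j = segment3 (vertex i a) (vertex i a')]].

(* A subset of space is a surface without boundary if it is locally homeomorphic
   to open subsets of the plane. (The polyhedron is compact, as a finite
   union of triangles, so for it this amounts to being a closed surface.) *)
Definition surface_without_boundary (S : set 'rV[R]_3) : Prop :=
  forall p, S p ->
  exists (U : set 'rV[R]_3) (V : set (R * R))
         (f : 'rV[R]_3 -> R * R) (h : R * R -> 'rV[R]_3),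
  [/\ open U /\ U p,
      open V,
      (forall q, (S `&` U) q -> V (f q) /\ h (f q) = q),
      (forall x, V x -> (S `&` U) (h x) /\ f (h x) = x) &
      {within S `&` U, continuous f} /\ {within V, continuous h}].

(* Two triangles sharing the edge from vertex i a to vertex i a' induce opposite
   orientations on it; c and d index the vertices opposite to this edge. *)
Definition coherently_oriented : Prop :=
  forall i j (a a' c b b' d : 'I_3), i != j ->
  uniq [:: a; a'; c] -> uniq [:: b; b'; d] ->
  vertex i a = vertex j b -> vertex i a' = vertex j b' ->
  let e := vertex i a' - vertex i a in
  inner (ref_normal i) (cross e (vertex i c - vertex i a))
  * inner (ref_normal j) (cross e (vertex j d - vertex j b)) < 0.

Definition closed_oriented_polyhedral_surface : Prop :=
  [/\ forall j, injective (amap j),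
      conforming,
      surface_without_boundary polyhedron,
      forall j, orthonormal_basis (frame j) (lin j) &
      coherently_oriented].

(* Surface integral of a function given piecewise on the triangles, through the
   parametrizations amap j. *)
Definition surf_int (F : 'I_(ntri g) -> 'rV[R]_3 -> R) : R :=
  \sum_j
    enorm (cross (row 0 (lin j)) (row 1 (lin j)))
    * \int[(@lebesgue_measure R \x @lebesgue_measure R)%E]_(x in @ref_triangle R)
        F j (amap j x).

(* Functions on a discrete surface are represented by their pull-backs to the
   polyhedron, i.e. by functions on space whose values off the polyhedron are
   irrelevant. *)

Definition poly_eval (q : mpoly 3 R) (p : 'rV[R]_3) : R :=
  meval (fun k => p 0 k) q.

Definition poly_on (l : nat) (S : set 'rV[R]_3) (v : 'rV[R]_3 -> R) : Prop :=
  exists q : mpoly 3 R,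
    {in msupp q, forall m, (mdeg m <= l)%N} /\
    forall p, S p -> v p = poly_eval q p.

Definition fe (l : nat) (v : 'rV[R]_3 -> R) : Prop :=
  {within polyhedron, continuous v} /\ forall j, poly_on l (triangle j) v.

Definition fe3 (l : nat) (v : 'rV[R]_3 -> 'rV[R]_3) : Prop :=
  forall k : 'I_3, fe l (fun p => v p 0 k).

(* Derivative of v restricted to the j-th triangle in the tangential direction t,
   for piecewise polynomial v. It is computed from a polynomial extension of this
   restriction to space: for t tangential it does not depend on the extension,
   and it makes sense on the whole closed triangle. *)
Definition tderiv j (t : 'rV[R]_3) (v : 'rV[R]_3 -> R) (p : 'rV[R]_3) : R :=
  let q := xget 0 [set q | forall x, triangle j x -> v x = poly_eval q x] in
  \sum_(k < 3) t 0 k * poly_eval (mderiv k q) p.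

Definition tderiv3 j (t : 'rV[R]_3) (v : 'rV[R]_3 -> 'rV[R]_3) (p : 'rV[R]_3) :
    'rV[R]_3 :=
  \row_k tderiv j t (fun x => v x 0 k) p.

Section DiscreteSurface.
Variable Y : 'rV[R]_3 -> 'rV[R]_3.

(* Row k is the derivative of Y along the k-th vector of the reference frame. *)
Definition jacobian j (p : 'rV[R]_3) : 'M[R]_(2, 3) :=
  \matrix_(k < 2) tderiv3 j (row k (frame j)) Y p.

Definition area_vector j (p : 'rV[R]_3) : 'rV[R]_3 :=
  cross (row 0 (jacobian j p)) (row 1 (jacobian j p)).

Definition unit_normal j (p : 'rV[R]_3) : 'rV[R]_3 :=
  (enorm (area_vector j p))^-1 *: area_vector j p.

(* An orthonormal basis of the tangent space of the curved element. *)
Definition tangent_frame j (p : 'rV[R]_3) : 'M[R]_(2, 3) :=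
  xget 0 [set T | orthonormal_basis T (jacobian j p)].

(* The tangent vector of the triangle which the derivative of Y maps to the k-th
   vector of tangent_frame. *)
Definition pulled_frame j (p : 'rV[R]_3) (k : 'I_2) : 'rV[R]_3 :=
  row k (tangent_frame j p) *m pinvmx (jacobian j p) *m frame j.

Definition sgrad (v : 'rV[R]_3 -> R) j (p : 'rV[R]_3) : 'rV[R]_3 :=
  \sum_(k < 2) tderiv j (pulled_frame j p k) v p *: row k (tangent_frame j p).

Definition sgrad3 (v : 'rV[R]_3 -> 'rV[R]_3) j (p : 'rV[R]_3) : 'M[R]_3 :=
  \sum_(k < 2)
    tensor (tderiv3 j (pulled_frame j p k) v p) (row k (tangent_frame j p)).

Definition surf_integral (F : 'I_(ntri g) -> 'rV[R]_3 -> R) : R :=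
  surf_int (fun j p => F j p * enorm (area_vector j p)).

Definition surf_dot (u v : 'rV[R]_3 -> R) : R :=
  surf_integral (fun _ p => u p * v p).

Definition surf_dot_mx (r s : nat)
    (u v : 'I_(ntri g) -> 'rV[R]_3 -> 'M[R]_(r, s)) : R :=
  surf_integral (fun j p => inner (u j p) (v j p)).

Definition area : R := surf_integral (fun _ _ => 1).

Definition positive_jacobian : Prop :=
  forall j p, triangle j p -> 0 < enorm (area_vector j p).

End DiscreteSurface.
End ReferenceGrid.

Variant flow := MCF | SD.

Section Scheme.
Variables (R : realType) (g : grid R).

Definition flow_form (fl : flow) (Y : 'rV[R]_3 -> 'rV[R]_3)
    (u v : 'rV[R]_3 -> R) : R :=
  match fl with
  | MCF => surf_dot g Y u v
  | SD => surf_dot_mx Y (@sgrad R g Y u) (@sgrad R g Y v)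
  end.

(* The pull-back of the identity is Y. *)
Definition scheme_solution (fl : flow) (l : nat) (tau : R)
    (Y X : 'rV[R]_3 -> 'rV[R]_3) (H : 'rV[R]_3 -> R) : Prop :=
  [/\ fe3 g l X,
      fe g l H,
      (forall phi, fe g l phi ->
         surf_dot_mx (g := g) Y (fun _ p => tau^-1 *: (X p - Y p))
                       (fun j p => phi p *: unit_normal Y j p)
         = flow_form fl Y H phi) &
      (forall eta, fe3 g l eta ->
         surf_dot_mx (g := g) Y (fun j p => H p *: unit_normal Y j p) (fun _ p => eta p)
         + surf_dot_mx Y (@sgrad3 R g Y X) (@sgrad3 R g Y eta) = 0)].

End Scheme.

(* Main.v *)
Require Import Defs.
From mathcomp Require Import all_boot all_order all_algebra.
From mathcomp Require Import all_classical all_reals all_analysis.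
From mathcomp Require Import -(notations) mpoly.
From mathcomp Require Import measurable_realfun ring lra.
(* Below, [jacobian] is the one of a discrete surface, not that of a
   differentiable map. *)
Import Defs.

Set Implicit Arguments.
Unset Strict Implicit.
Unset Printing Implicit Defensive.

Import Order.TTheory GRing.Theory Num.Theory.
Import numFieldNormedType.Exports.
Local Open Scope classical_set_scope.
Local Open Scope ring_scope.

(** Why the area decreases. Testing the first equation of the scheme with
    [phi := H] and the second one with [eta := (X - Y) / tau] makes the two
    coupling terms [((X - Y) / tau, H n)] and [(H n, (X - Y) / tau)] coincide,
    so that
      [(grad X, grad ((X - Y) / tau)) = - flow_form H H].
    The energy law for one step thus reduces to
      [area X - area Y <= tau (grad X, grad ((X - Y) / tau))]
    ([area_diff_le]), and the theorem follows by summing over the steps.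

    That inequality holds pointwise ([area_change_le_inner]). Take a point of a
    triangle, write [J] and [K] for the derivatives of [Y] and [X] there, and
    let [C] be the change of basis for which the rows of [T = C J] are
    orthonormal. The surface gradients of [X] and [Y] are [C K] and [T] in the
    frame [T] (up to transposition), so
      [<C K, C K - C J> >= (|C K|^2 - |T|^2) / 2 >= area (C K) - 1],
    first because [|C K - T|^2 >= 0], then because [|T|^2 = 2] and a
    parallelogram has at most half the sum of the squares of its sides as its
    area. Multiplying by [area J = 1 / |det C|] gives [area K - area J].

    Two points need care.
    - Integrability. The orthonormal frames are merely chosen, hence need not
      depend measurably on the point. The integrand does not depend on this
      choice: [C^T C] is the inverse of the Gram matrix [J J^T], which makes it
      a quotient of polynomials by the positive function [area J]
      ([inner_mulmx_gram], [tame_grad_density]), and continuous functions on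
      the compact reference triangle are integrable.
    - Linearity. A tangential derivative is computed from some polynomial
      extension of the function to space. It does not depend on the extension
      ([tderivE]), since a polynomial that vanishes on a triangle has zero
      derivatives in the directions of its plane ([dir_deriv_vanish]). *)

(** * Gram matrices and areas of parallelograms *)

Definition pgram_area {R : realType} (B : 'M[R]_(2, 3)) : R :=
  enorm (cross (row 0 B) (row 1 B)).

Section Gram.
Context {R : realType}.

Lemma innerC p q (A B : 'M[R]_(p, q)) : inner A B = inner B A.
Proof. by apply: eq_bigr => i _; apply: eq_bigr => j _; exact: mulrC. Qed.

Lemma inner_mxtrace p q (A B : 'M[R]_(p, q)) : inner A B = \tr (A *m B^T).
Proof.
by apply: eq_bigr => i _; rewrite mxE; apply: eq_bigr => j _; rewrite mxE.
Qed.

Lemma inner_ge0 p q (A : 'M[R]_(p, q)) : 0 <= inner A A.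
Proof. by do 2!(apply: sumr_ge0 => ? _); rewrite -expr2 sqr_ge0. Qed.

Lemma sum_ord2 (F : 'I_2 -> R) : \sum_i F i = F 0 + F 1.
Proof.
by rewrite !big_ord_recl big_ord0 addr0; congr (_ + F _); apply/val_inj.
Qed.

Lemma sum_ord3 (F : 'I_3 -> R) : \sum_i F i = F 0 + F 1 + F 2%:R.
Proof.
rewrite !big_ord_recl big_ord0 addr0 addrA.
by congr (_ + F _ + F _); apply/val_inj.
Qed.

Lemma det_mx2 (A : 'M[R]_2) : \det A = A 0 0 * A 1 1 - A 0 1 * A 1 0.
Proof.
rewrite (expand_det_row A 0) sum_ord2 /cofactor !det_mx11 !mxE /=.
have -> : lift 0 0 = 1 :> 'I_2 by apply/val_inj.
have -> : lift 1 0 = 0 :> 'I_2 by apply/val_inj.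
by rewrite expr0 expr1; ring.
Qed.

(** Lagrange's identity. It trades cross products for Gram determinants, which
    are multiplicative under a change of basis. *)
Lemma inner_cross (B : 'M[R]_(2, 3)) :
  inner (cross (row 0 B) (row 1 B)) (cross (row 0 B) (row 1 B)) =
  \det (B *m B^T).
Proof.
rewrite det_mx2 /inner big_ord1 !mxE !sum_ord3 !mxE.
have -> : (1 + 1 = 2%:R :> 'I_3) by apply/val_inj.
have -> : (1 + 2%:R = 0 :> 'I_3) by apply/val_inj.
have -> : (2%:R + 2%:R = 1 :> 'I_3) by apply/val_inj.
have -> : (2%:R + 1 = 0 :> 'I_3) by apply/val_inj.
by rewrite !add0r; ring.
Qed.

Lemma pgram_area_ge0 (B : 'M[R]_(2, 3)) : 0 <= pgram_area B.
Proof. exact: sqrtr_ge0. Qed.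

Lemma sqr_pgram_area (B : 'M[R]_(2, 3)) : pgram_area B ^+ 2 = \det (B *m B^T).
Proof.
by rewrite sqr_sqrtr ?inner_ge0// inner_cross.
Qed.

Lemma pgram_area_mulmx (C : 'M[R]_2) (B : 'M[R]_(2, 3)) :
  pgram_area (C *m B) = `|\det C| * pgram_area B.
Proof.
rewrite /pgram_area /enorm !inner_cross trmx_mul mulmxA -(mulmxA C) !det_mulmx det_tr.
by rewrite mulrAC -expr2 sqrtrM ?sqr_ge0// sqrtr_sqr.
Qed.

(** With [E], [F], [G] the entries of the Gram matrix, the area is
    [sqrt (E G - F^2)], which is at most [sqrt (E G)], hence at most the
    arithmetic mean of [E] and [G]. *)
Lemma pgram_area_le (B : 'M[R]_(2, 3)) : pgram_area B <= inner B B / 2.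
Proof.
have h : 0 <= inner B B / 2 by rewrite divr_ge0// inner_ge0.
rewrite -[leRHS]ger0_norm// -sqrtr_sqr ler_wsqrtr// inner_cross det_mx2.
rewrite inner_mxtrace /mxtrace sum_ord2.
have -> : (B *m B^T) 1 0 = (B *m B^T) 0 1.
  by rewrite !mxE; apply: eq_bigr => k _; rewrite !mxE mulrC.
set a := _ 0 0; set b := _ 1 1; set c := _ 0 1.
by have := sqr_ge0 (a - b); have := sqr_ge0 c; nra.
Qed.

Lemma eq_mx2 (A B : 'M[R]_2) : A 0 0 = B 0 0 -> A 0 1 = B 0 1 ->
  A 1 0 = B 1 0 -> A 1 1 = B 1 1 -> A = B.
Proof.
have e i : i = 0 \/ i = 1 :> 'I_2.
  by case: i => -[|[|//]] ?; [left | right]; apply/val_inj.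
by move=> ? ? ? ?; apply/matrixP => i j; case: (e i) => ->; case: (e j) => ->.
Qed.

(** The inverse of the Cholesky factor of a positive definite [G]. *)
Lemma cholesky2 (G : 'M[R]_2) : G 1 0 = G 0 1 -> 0 < G 0 0 -> 0 < \det G ->
  exists C : 'M[R]_2, C *m G *m C^T = 1%:M.
Proof.
move=> Gsym G0 dG; set e := Num.sqrt (G 0 0); set d := Num.sqrt (\det G).
have e0 : e != 0 by rewrite gt_eqF// sqrtr_gt0.
have d0 : d != 0 by rewrite gt_eqF// sqrtr_gt0.
have e2 : e ^+ 2 = G 0 0 by rewrite sqr_sqrtr// ltW.
have d2 : d ^+ 2 = \det G by rewrite sqr_sqrtr// ltW.
have G11 : G 1 1 = (d ^+ 2 + G 0 1 ^+ 2) / e ^+ 2.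
  by rewrite d2 det_mx2 Gsym e2; field; rewrite gt_eqF.
exists (\matrix_(i, k) if i == 0 then (if k == 0 then e^-1 else 0)
  else (if k == 0 then - G 0 1 / (e * d) else e / d)).
by apply: eq_mx2; rewrite !mxE !sum_ord2 !mxE !sum_ord2 !mxE /= Gsym G11 -e2;
  field; rewrite ?e0 ?d0.
Qed.

(** Gram-Schmidt: the positive area makes the Gram matrix of the rows positive
    definite, and the inverse Cholesky factor orthonormalizes them. *)
Lemma orthonormal_basis_ex (J : 'M[R]_(2, 3)) :
  0 < pgram_area J -> exists T, orthonormal_basis T J.
Proof.
move=> J0; set G := J *m J^T.
have dG : 0 < \det G by rewrite -sqr_pgram_area exprn_gt0.
have Gsym : G 1 0 = G 0 1.
  by rewrite !mxE; apply: eq_bigr => k _; rewrite !mxE mulrC.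
have G0 : 0 < G 0 0.
  have : 0 <= G 0 0.
    by rewrite mxE sumr_ge0// => k _; rewrite mxE -expr2 sqr_ge0.
  rewrite le_eqVlt => /orP[/eqP e|//]; move: dG.
  by rewrite det_mx2 -e Gsym mul0r sub0r oppr_gt0 ltNge -expr2 sqr_ge0.
have [C CG] := cholesky2 Gsym G0 dG.
have /mulmx1_unit[Cu _] : C *m (G *m C^T) = 1%:M by rewrite mulmxA.
exists (C *m J); split; first by rewrite trmx_mul mulmxA -(mulmxA C).
apply/eqmxP; apply: eqmxMfull; rewrite row_full_unit //.
Qed.

(** The pointwise form of the energy inequality. As [C J] has area 1, the factor
    [area J] is [1 / |det C|]: it turns the area of [C K] into that of [K]. The
    rest is [<A, A - T> >= (|A|^2 - |T|^2) / 2] for [A = C K], and [|T|^2 = 2]. *)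
Lemma area_change_le_inner (tau : R) (C : 'M[R]_2) (J K : 'M[R]_(2, 3)) :
  0 < tau -> 0 < pgram_area J -> (C *m J) *m (C *m J)^T = 1%:M ->
  tau^-1 * (pgram_area K - pgram_area J)
    <= inner (C *m K) (C *m (tau^-1 *: (K - J))) * pgram_area J.
Proof.
move=> tau0 J0 CJ.
have CJ1 : pgram_area (C *m J) = 1 by rewrite /pgram_area /enorm inner_cross CJ det1 sqrtr1.
have dC : `|\det C| * pgram_area J = 1 by rewrite -pgram_area_mulmx.
have CK : pgram_area (C *m K) * pgram_area J = pgram_area K.
  by rewrite pgram_area_mulmx mulrAC dC mul1r.
rewrite -scalemxAr mulmxBr; set A := C *m K in CK *; set T := C *m J in CJ *.
have TT : inner T T = 2 by rewrite inner_mxtrace CJ mxtrace1.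
have -> : inner A (tau^-1 *: (A - T)) = tau^-1 * (inner A A - inner A T).
  rewrite /inner -sumrB mulr_sumr; apply: eq_bigr => i _.
  by rewrite -sumrB mulr_sumr; apply: eq_bigr => j _; rewrite !mxE; ring.
have : 0 <= inner A A - 2 * inner A T + inner T T.
  have -> : inner A A - 2 * inner A T + inner T T = inner (A - T) (A - T).
    rewrite /inner mulr_sumr -sumrB -big_split; apply: eq_bigr => i _ /=.
    by rewrite mulr_sumr -sumrB -big_split; apply: eq_bigr => j _ /=; rewrite !mxE; ring.
  exact: inner_ge0.
rewrite TT => h; rewrite -mulrA ler_pM2l ?invr_gt0//.
rewrite -CK -[X in _ - X]mul1r -mulrBl ler_pM2r//.
by have := pgram_area_le A; lra.
Qed.

(** The left-hand side does not depend on the orthonormal basis [C J], because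
    [C^T C] is the inverse of the Gram matrix of [J]. The right-hand side only
    involves polynomials in the entries and a division by [area J], so its
    regularity in [J], [K], [L] can be read off. *)
Lemma inner_mulmx_gram (C : 'M[R]_2) (J K L : 'M[R]_(2, 3)) :
  (C *m J) *m (C *m J)^T = 1%:M -> 0 < pgram_area J ->
  inner (C *m K) (C *m L) * pgram_area J =
    \tr (\adj (J *m J^T) *m (K *m L^T)) / pgram_area J.
Proof.
move=> CJ J0; set G := J *m J^T.
have CG : C *m (G *m C^T) = 1%:M.
  by rewrite -CJ trmx_mul !mulmxA.
have GS : G *m (C^T *m C) = 1%:M by rewrite mulmxA (mulmx1C CG).
have adj : \adj G = (\det G) *: (C^T *m C).
  by rewrite -mul_scalar_mx -mul_adj_mx -mulmxA GS mulmx1.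
rewrite adj -sqr_pgram_area -scalemxAl mxtraceZ inner_mxtrace.
have -> : \tr (C *m K *m (C *m L)^T) = \tr (C^T *m C *m (K *m L^T)).
  by rewrite trmx_mul (mulmxA _ L^T) (mxtrace_mulC _ C^T) !mulmxA.
by field; rewrite gt_eqF.
Qed.

Lemma inner_frame (A B T : 'M[R]_(2, 3)) : T *m T^T = 1%:M ->
  inner (A^T *m T) (B^T *m T) = inner A B.
Proof.
move=> TT; rewrite !inner_mxtrace trmx_mul trmxK mulmxA -(mulmxA _ T) TT mulmx1.
by rewrite mxtrace_mulC -mxtrace_tr trmx_mul trmxK.
Qed.

End Gram.

(** * Integrable functions on the reference triangle *)

(** Continuity gives boundedness on a compact set. Measurability is carried
    along separately, for the product sigma-algebra of the plane: both are
    preserved by the same operations, which avoids comparing that algebra with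
    the Borel sets of the plane. *)
Definition tame {R : realType} (D : set (R * R)) (f : R * R -> R) : Prop :=
  {within D, continuous f} /\ measurable_fun D f.

Section Tame.
Context {R : realType} {D : set (R * R)}.
Implicit Types f h : R * R -> R.

Lemma tame_cst c : tame D (fun=> c).
Proof. by split; [exact: cst_continuous | exact: measurable_cst]. Qed.

Lemma tame_fst : tame D fst.
Proof.
split; last exact: measurable_funTS measurable_fst.
by apply: continuous_subspaceT => x; exact: cvg_fst.
Qed.

Lemma tame_snd : tame D snd.
Proof.
split; last exact: measurable_funTS measurable_snd.
by apply: continuous_subspaceT => x; exact: cvg_snd.
Qed.

Lemma tameD f h : tame D f -> tame D h -> tame D (fun x => f x + h x).
Proof.
move=> [cf mf] [ch mh]; split; last exact: measurable_funD.
by move=> x; apply: continuousD; [exact: cf | exact: ch].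
Qed.

Lemma tameM f h : tame D f -> tame D h -> tame D (fun x => f x * h x).
Proof.
move=> [cf mf] [ch mh]; split; last exact: measurable_funM.
by move=> x; apply: continuousM; [exact: cf | exact: ch].
Qed.

Lemma tameB f h : tame D f -> tame D h -> tame D (fun x => f x - h x).
Proof.
move=> [cf mf] [ch mh]; split; last exact: measurable_funB.
by move=> x; apply: continuousB; [exact: cf | exact: ch].
Qed.

Lemma tame_sum (I : Type) (r : seq I) (P : pred I) (F : I -> R * R -> R) :
  (forall i, tame D (F i)) -> tame D (fun x => \sum_(i <- r | P i) F i x).
Proof.
move=> tF; elim: r => [|i r IH].
  by under eq_fun do rewrite big_nil; exact: tame_cst.
under eq_fun do rewrite big_cons.
by case: (P i) => //; exact: tameD.
Qed.

Lemma tame_sqrt f : tame D f -> tame D (fun x => Num.sqrt (f x)).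
Proof.
move=> [cf mf]; split.
  by move=> x; apply: continuous_comp; [exact: cf | exact: sqrt_continuous].
apply: measurableT_comp => //.
by apply: continuous_measurable_fun; exact: sqrt_continuous.
Qed.

Lemma tame_eq f h : {in D, f =1 h} -> tame D f -> tame D h.
Proof.
move=> fh [cf mf]; split; last exact: eq_measurable_fun mf.
exact: subspace_eq_continuous cf.
Qed.

Lemma tameV f : (forall x, D x -> 0 < f x) -> tame D f ->
  tame D (fun x => (f x)^-1).
Proof.
move=> f0 [cf mf]; split.
  rewrite continuous_subspace_in => x xD; apply: continuousV; last exact: cf.
  by rewrite gt_eqF// f0//; exact: set_mem.
(* On positive reals the inverse is a real power, and those are measurable. *)
apply: (@eq_measurable_fun _ _ _ _ _ (fun x => f x `^ (-1))).
  by move=> x /set_mem/f0/ltW fx; rewrite powR_inv1.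
by apply: (measurableT_comp (f := fun y => y `^ (-1)) _ mf); exact: measurable_powR.
Qed.
End Tame.

Section RefTriangle.
Context {R : realType}.
Notation T := (@ref_triangle R).

Lemma ref_triangle_compact : compact T.
Proof.
apply: (@subclosed_compact _ _ (`[0 : R, 1 : R] `*` `[0 : R, 1 : R])).
- have -> : T = fst @^-1` [set x | 0 <= x] `&` (snd @^-1` [set x | 0 <= x] `&`
     (fun x : R * R => x.1 + x.2) @^-1` [set x | x <= 1]) by [].
  apply: closedI; [|apply: closedI].
  + by apply: (@preimage_closed _ _ fst) => [x _|]; [exact: cvg_fst | exact: closed_ge].
  + by apply: (@preimage_closed _ _ snd) => [x _|]; [exact: cvg_snd | exact: closed_ge].
  + apply: (@preimage_closed _ _ (fun x : R * R => x.1 + x.2)) => [x _|]; last exact: closed_le.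
    by apply: cvgD; [exact: cvg_fst | exact: cvg_snd].
- by apply: compact_setX; exact: segment_compact.
- by move=> [x y] [/= x0 [y0 xy]]; rewrite !in_itv/=; split; lra.
Qed.

Lemma ref_triangle_measurable : measurable T.
Proof.
have -> : T = setT `&` (fst @^-1` `[0, +oo[) `&` (setT `&` (snd @^-1` `[0, +oo[) `&`
    (setT `&` (fun x : R * R => x.1 + x.2) @^-1` `]-oo, 1])).
  by rewrite !setTI; apply/seteqP; split=> -[x y]; rewrite /ref_triangle /= !in_itv/= !andbT.
apply: measurableI; [|apply: measurableI].
- by apply: measurable_fst => //; exact: measurable_itv.
- by apply: measurable_snd => //; exact: measurable_itv.
- by apply: (measurable_funD measurable_fst measurable_snd) => //; exact: measurable_itv.
Qed.

Notation mu := (@lebesgue_measure R \x @lebesgue_measure R)%E.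

Lemma tame_integrable f : tame T f -> mu.-integrable T (EFin \o f).
Proof.
move=> [cf mf]; apply: measurable_bounded_integrable => //.
- exact: ref_triangle_measurable.
- apply: (@le_lt_trans _ _ (mu (`[0, 1] `*` `[0, 1]))).
    apply: le_measure; rewrite ?inE.
    + exact: ref_triangle_measurable.
    + by apply: measurableX; exact: measurable_itv.
    + by move=> [x y] [/= x0 [y0 xy]]; rewrite !in_itv/=; split; lra.
  rewrite product_measure1E; try exact: measurable_itv.
  rewrite [ltLHS](_ : _ = lebesgue_measure `[0%R, 1%R] * lebesgue_measure `[0%R, 1%R])%E//.
  by rewrite lebesgue_measure_itv/= lte_fin ltr01 -EFinB -EFinM ltry.
- have := compact_bounded (continuous_compact cf ref_triangle_compact).
  by move=> [M [Mr HM]]; exists M; split=> // r /HM H x Tx; apply: H; exists x.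
Qed.
End RefTriangle.

(** * Derivatives of polynomials along a triangle *)

Definition dir_deriv {R : realType} (q : mpoly 3 R) (t p : 'rV[R]_3) : R :=
  \sum_(k < 3) t 0 k * poly_eval (mderiv k q) p.

Section PolynomialDerivative.
Context {R : realType}.
Implicit Types (q r : mpoly 3 R) (p t d : 'rV[R]_3).

(** Polynomials are generated as a ring by constants and variables, which suits
    properties that respect products, such as the Leibniz rule. *)
Lemma mpoly_ring_ind (P : mpoly 3 R -> Prop) :
  (forall c, P (mpolyC 3 c)) -> (forall i, P (mpolyX R (mnm1 i))) ->
  (forall q r, P q -> P r -> P (q + r)) ->
  (forall q r, P q -> P r -> P (q * r)) -> forall q, P q.
Proof.
move=> PC PX PD PM; have P1 : P 1 by exact: (PC 1).
apply: mpolyind => [|c m q _ _ Pq]; first by rewrite -(mpolyC0 3 R).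
apply: (PD) => //; rewrite -mul_mpolyC; apply: (PM) => //.
rewrite mpolyXE_id; apply: (big_ind P) => // i _.
by elim: (m i) => [|n IH]; rewrite ?expr0 ?exprS//; apply: PM.
Qed.

Lemma dir_derivC c t p : dir_deriv (mpolyC 3 c) t p = 0.
Proof. by rewrite /dir_deriv big1// => k _; rewrite mderivC /poly_eval meval0 mulr0. Qed.

Lemma dir_derivXU i t p : dir_deriv (mpolyX R (mnm1 i)) t p = t 0 i.
Proof.
rewrite /dir_deriv (bigD1 i)//= big1 => [|k ki]; rewrite mderivX mnm1E.
  rewrite eqxx scale1r /poly_eval mevalX addr0.
  rewrite big1 ?mulr1// => k _.
  by rewrite mnmBE subnn expr0.
by rewrite eq_sym (negPf ki) scale0r /poly_eval meval0 mulr0.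
Qed.

Lemma dir_derivD q r t p : dir_deriv (q + r) t p = dir_deriv q t p + dir_deriv r t p.
Proof.
rewrite /dir_deriv -big_split; apply: eq_bigr => k _ /=.
by rewrite mderivD /poly_eval mevalD mulrDr.
Qed.

Lemma dir_derivM q r t p : dir_deriv (q * r) t p =
  dir_deriv q t p * poly_eval r p + poly_eval q p * dir_deriv r t p.
Proof.
rewrite /dir_deriv mulr_suml mulr_sumr -big_split; apply: eq_bigr => k _ /=.
by rewrite mderivM /poly_eval mevalD !mevalM; ring.
Qed.

Lemma dir_derivZB c q r t p :
  dir_deriv (c *: (q - r)) t p = c * (dir_deriv q t p - dir_deriv r t p).
Proof.
rewrite /dir_deriv -sumrB mulr_sumr; apply: eq_bigr => k _.
by rewrite mderivZ mderivB /poly_eval mevalZ mevalB; ring.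
Qed.

Lemma dir_deriv_lin q (n : nat) (a : 'rV[R]_n) (B : 'M[R]_(n, 3)) p :
  dir_deriv q (a *m B) p = \sum_i a 0 i * dir_deriv q (row i B) p.
Proof.
rewrite /dir_deriv; under [RHS]eq_bigr do rewrite mulr_sumr.
rewrite exchange_big; apply: eq_bigr => k _ /=.
by rewrite mxE mulr_suml; apply: eq_bigr => i _; rewrite mxE; ring.
Qed.

(** The chain rule on a line: it reduces vanishing of a derivative in space to
    the univariate case. *)
Lemma poly_eval_on_line q p d : exists P : {poly R},
  forall s, P.[s] = poly_eval q (p + s *: d) /\
            (deriv P).[s] = dir_deriv q d (p + s *: d).
Proof.
move: q; apply: mpoly_ring_ind => [c|i|q r [P HP] [Q HQ]|q r [P HP] [Q HQ]].
- exists c%:P => s; by rewrite derivC !hornerC dir_derivC /poly_eval mevalC.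
- exists ((p 0 i)%:P + (d 0 i)%:P * 'X) => s.
  by rewrite dir_derivXU /poly_eval mevalXU !poly.derivE !hornerE !mxE; split; ring.
- exists (P + Q) => s; have [h1 h2] := HP s; have [h3 h4] := HQ s.
  by rewrite dir_derivD derivD !hornerD h1 h2 h3 h4 /poly_eval mevalD.
- exists (P * Q) => s; have [h1 h2] := HP s; have [h3 h4] := HQ s.
  by rewrite dir_derivM derivM hornerD !hornerM h1 h2 h3 h4 /poly_eval mevalM.
Qed.

Lemma poly_vanish_unit (P : {poly R}) :
  (forall s, 0 <= s <= 1 -> P.[s] = 0) -> P = 0.
Proof.
move=> P0; apply/eqP/contraT => Pn0.
(* More roots than the degree allows: 1, 1/2, 1/3, and so on. *)
pose rs : seq R := [seq i.+1%:R^-1 | i <- iota 0 (size P)].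
have := @max_poly_roots _ P rs Pn0.
rewrite size_map size_iota ltnn; apply.
  apply/allP => _ /mapP[i _ ->]; apply/rootP/P0.
  by rewrite invr_ge0 ler0n invf_le1 ?ltr0n// ler1n.
rewrite map_inj_uniq ?iota_uniq// => i k /invr_inj/eqP.
by rewrite eqr_nat => /eqP[].
Qed.
End PolynomialDerivative.

Section TangentialDerivative.
Context {R : realType} {g : grid R}.
Implicit Types (j : 'I_(ntri g)) (q : mpoly 3 R) (p t : 'rV[R]_3).

Lemma tame_poly_eval (D : set (R * R)) j q :
  tame D (fun x => poly_eval q (amap j x)).
Proof.
move: q; apply: mpoly_ring_ind => [c|i|q r|q r].
- by rewrite /poly_eval; under eq_fun do rewrite mevalC; exact: tame_cst.
- rewrite /poly_eval; under eq_fun do rewrite mevalXU !mxE.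
  by do !apply: tameD; try exact: tame_cst; apply: tameM;
    by [exact: tame_cst | exact: tame_fst | exact: tame_snd].
- by move=> tq tr; rewrite /poly_eval; under eq_fun do rewrite mevalD; exact: tameD.
- by move=> tq tr; rewrite /poly_eval; under eq_fun do rewrite mevalM; exact: tameM.
Qed.

Lemma amap_line j (x y : R * R) s : amap j x + s *: (amap j y - amap j x) =
  amap j (x.1 + s * (y.1 - x.1), x.2 + s * (y.2 - x.2)).
Proof. by apply/rowP => k; rewrite !mxE /=; ring. Qed.

(** The segment from [p] to [w] lies in the triangle, so the polynomial vanishes
    along it. This also covers points [p] on the boundary. *)
Lemma dir_deriv_vanish_to j q p w : (forall z, triangle j z -> poly_eval q z = 0) ->
  triangle j p -> triangle j w -> dir_deriv q (w - p) p = 0.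
Proof.
move=> q0 [x [x1 [x2 x3]] <-] [y [y1 [y2 y3]] <-].
have [P HP] := poly_eval_on_line q (amap j x) (amap j y - amap j x).
have P0 : P = 0.
  apply: poly_vanish_unit => s /andP[s0 s1]; rewrite (HP s).1 amap_line.
  apply: q0; eexists => //; split=> /=; [nra|split; nra].
by have := (HP 0).2; rewrite scale0r addr0 => <-; rewrite P0 deriv0 horner0.
Qed.

(** Every tangential direction is a combination of directions from [p] to the
    vertices: an edge vector is the difference of two of these. *)
Lemma dir_deriv_vanish j q p t : (forall z, triangle j z -> poly_eval q z = 0) ->
  triangle j p -> (t <= lin j)%MS -> dir_deriv q t p = 0.
Proof.
move=> q0 Tp /submxP[a ->]; rewrite dir_deriv_lin big1// => i _.
pose v (i : 'I_2) : R * R := ((i == 0)%:R, (i == 1)%:R).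
have Tv x : 0 <= x.1 -> 0 <= x.2 -> x.1 + x.2 <= 1 -> triangle j (amap j x).
  by move=> *; exists x.
(* The edge vector is (vertex i+1 - p) - (vertex 0 - p). *)
have -> : row i (lin j) = \row_(k < 2) (if k == 0 then 1 else -1) *m
    \matrix_(k < 2) (amap j (if k == 0 then v i else 0) - p).
  apply/rowP => k; rewrite mxE mxE sum_ord2 !mxE /=.
  have [->|->] : i = 0 \/ i = 1.
    by case: i => -[|[|//]] ?; [left | right]; apply/val_inj.
  - by rewrite /=; ring.
  - by rewrite /=; ring.
rewrite dir_deriv_lin big1 ?mulr0// => k _; rewrite rowK.
rewrite (dir_deriv_vanish_to q0 Tp) ?mulr0//.
apply: Tv; case: (k == 0); case: i => -[|[|//]] ? /=; lra.
Qed.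

Lemma tderivE j t (v : 'rV[R]_3 -> R) q p :
  (forall z, triangle j z -> v z = poly_eval q z) ->
  triangle j p -> (t <= lin j)%MS -> tderiv j t v p = dir_deriv q t p.
Proof.
move=> vq Tp tl; rewrite /tderiv; set q' := xget _ _; rewrite -/(dir_deriv q' t p).
have : (forall z, triangle j z -> v z = poly_eval q' z).
  by apply: (@xgetPex _ 0 [set q | forall x, triangle j x -> v x = poly_eval q x]); exists q.
move=> vq'; apply/eqP; rewrite -subr_eq0; apply/eqP.
have := dir_derivZB 1 q' q t p; rewrite mul1r => <-.
apply: (dir_deriv_vanish _ Tp tl) => z Tz.
by rewrite /poly_eval mevalZ mevalB -!/(poly_eval _ _) -vq// -vq'// subrr mulr0.
Qed.

Lemma tderiv_lin j (n : nat) (a : 'rV[R]_n) (B : 'M[R]_(n, 3)) v p :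
  tderiv j (a *m B) v p = \sum_i a 0 i * tderiv j (row i B) v p.
Proof. exact: dir_deriv_lin. Qed.

Lemma tderivZB l j t c u v p : poly_on l (triangle j) u -> poly_on l (triangle j) v ->
  triangle j p -> (t <= lin j)%MS ->
  tderiv j t (fun z => c * (u z - v z)) p = c * (tderiv j t u p - tderiv j t v p).
Proof.
move=> [q [_ uq]] [r [_ vr]] Tp tl.
rewrite (@tderivE j t _ (c *: (q - r)))//.
  by rewrite (@tderivE j t u q)// (@tderivE j t v r)// dir_derivZB.
by move=> z Tz; rewrite uq// vr// /poly_eval mevalZ mevalB.
Qed.

Lemma eq_tderiv j t u v p : (forall z, triangle j z -> u z = v z) ->
  tderiv j t u p = tderiv j t v p.
Proof.
move=> uv; rewrite /tderiv.
suff -> : [set q | forall z, triangle j z -> u z = poly_eval q z] =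
          [set q | forall z, triangle j z -> v z = poly_eval q z] by [].
by apply/seteqP; split=> q /= qE z Tz; rewrite -qE// uv.
Qed.
End TangentialDerivative.

(** * Pull-backs of jacobians and surface integrals *)

Section TameMatrix.
Context {R : realType} {D : set (R * R)}.

Definition tame_mx {m n} (F : R * R -> 'M[R]_(m, n)) : Prop :=
  forall i k, tame D (fun x => F x i k).

Lemma tame_mulmx m n r (F : R * R -> 'M[R]_(m, n)) (E : R * R -> 'M[R]_(n, r)) :
  tame_mx F -> tame_mx E -> tame_mx (fun x => F x *m E x).
Proof.
move=> tF tE i k; under eq_fun do rewrite mxE.
by apply: tame_sum => l; exact: tameM.
Qed.

Lemma tame_trmx m n (F : R * R -> 'M[R]_(m, n)) :
  tame_mx F -> tame_mx (fun x => (F x)^T).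
Proof. by move=> tF i k; under eq_fun do rewrite mxE. Qed.

Lemma tame_adj2 (F : R * R -> 'M[R]_2) : tame_mx F -> tame_mx (fun x => \adj (F x)).
Proof.
move=> tF i k; under eq_fun do rewrite mxE /cofactor det_mx11 !mxE.
by apply: tameM => //; exact: tame_cst.
Qed.

Lemma tame_det2 (F : R * R -> 'M[R]_2) : tame_mx F -> tame D (fun x => \det (F x)).
Proof.
by move=> tF; under eq_fun do rewrite det_mx2; apply: tameB; exact: tameM.
Qed.

Lemma tame_mxtrace n (F : R * R -> 'M[R]_n) : tame_mx F -> tame D (fun x => \tr (F x)).
Proof. by move=> tF; exact: tame_sum. Qed.

Lemma tame_pgram_area (F : R * R -> 'M[R]_(2, 3)) :
  tame_mx F -> tame D (fun x => pgram_area (F x)).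
Proof.
move=> tF; rewrite /pgram_area /enorm; under eq_fun do rewrite inner_cross.
by apply/tame_sqrt/tame_det2/tame_mulmx => //; exact: tame_trmx.
Qed.
End TameMatrix.
Arguments tame_mx {R} D {m n} F.

Section DiscreteSurface.
Context {R : realType} {g : grid R}.
Notation T := (@ref_triangle R).
Implicit Types (j : 'I_(ntri g)) (p : 'rV[R]_3).
Implicit Types (F G : 'I_(ntri g) -> 'rV[R]_3 -> R) (u v Y X : 'rV[R]_3 -> 'rV[R]_3).

Lemma tame_jacobian (D : set (R * R)) v j : tame_mx D (fun x => jacobian v j (amap j x)).
Proof.
move=> i k; under eq_fun do rewrite !mxE /tderiv.
by apply: tame_sum => m; apply: tameM; [exact: tame_cst | exact: tame_poly_eval].
Qed.

Lemma le_surf_int F G : (forall j, tame T (F j \o amap j)) ->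
  (forall j, tame T (G j \o amap j)) ->
  (forall j p, triangle j p -> F j p <= G j p) -> surf_int F <= surf_int G.
Proof.
move=> tF tG FG; apply: ler_sum => j _; apply: ler_wpM2l; first exact: pgram_area_ge0.
apply: le_Rintegral; first exact: ref_triangle_measurable.
- exact: (tame_integrable (tF j)).
- exact: (tame_integrable (tG j)).
- by move=> x Tx; apply: FG; exists x.
Qed.

Lemma surf_intZB c F G : (forall j, tame T (F j \o amap j)) ->
  (forall j, tame T (G j \o amap j)) ->
  surf_int (fun j p => c * (F j p - G j p)) = c * (surf_int F - surf_int G).
Proof.
move=> tF tG; rewrite /surf_int -sumrB mulr_sumr; apply: eq_bigr => j _.
have mT := @ref_triangle_measurable R.
rewrite RintegralZl//; last first.
  exact: tame_integrable (tameB (tF j) (tG j)).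
rewrite RintegralB//; last 2 first.
- exact: (tame_integrable (tF j)).
- exact: (tame_integrable (tG j)).
by rewrite -mulrBr mulrCA.
Qed.

Lemma eq_surf_int F G : (forall j p, triangle j p -> F j p = G j p) ->
  surf_int F = surf_int G.
Proof.
move=> FG; apply: eq_bigr => j _; congr (_ * _); apply: eq_Rintegral => x /set_mem Tx.
by apply: FG; exists x.
Qed.

(** * The surface gradient and the energy inequality *)

Context (frame_lin : forall j, orthonormal_basis (frame j) (lin j)).

Lemma jacobianZB l c u v j p : fe3 g l u -> fe3 g l v -> triangle j p ->
  jacobian (fun z => c *: (u z - v z)) j p = c *: (jacobian u j p - jacobian v j p).
Proof.
move=> fu fv Tp; apply/matrixP => i k; rewrite !mxE.
have [_ /eqmxP fl] := frame_lin j.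
rewrite -(@tderivZB _ _ l)//; [|exact: (fu k).2|exact: (fv k).2|by rewrite -fl row_sub].
by congr tderiv; apply/funext => z; rewrite !mxE.
Qed.

Lemma tangent_frameP Y j p : 0 < pgram_area (jacobian Y j p) ->
  orthonormal_basis (tangent_frame Y j p) (jacobian Y j p).
Proof. by move=> /orthonormal_basis_ex; exact: xgetPex. Qed.

(** The coefficients of the orthonormal tangent frame in the basis formed by the
    rows of the jacobian. The same coefficients express the pulled-back frame in
    the reference frame, hence also the surface gradient of any function. *)
Definition frame_coef Y j p : 'M[R]_2 := tangent_frame Y j p *m pinvmx (jacobian Y j p).

Lemma frame_coefK Y j p : 0 < pgram_area (jacobian Y j p) ->
  frame_coef Y j p *m jacobian Y j p = tangent_frame Y j p.
Proof. by move=> /tangent_frameP[_ /eqmxP e]; rewrite mulmxKpV// e. Qed.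

Lemma sgrad3E Y v j p : sgrad3 Y v j p =
  (frame_coef Y j p *m jacobian v j p)^T *m tangent_frame Y j p.
Proof.
apply/matrixP => a b; rewrite summxE mxE; apply: eq_bigr => k _.
rewrite /tensor mxE big_ord1 !mxE; congr (_ * _).
rewrite /pulled_frame -!row_mul -/(frame_coef _ _ _) row_mul tderiv_lin.
by apply: eq_bigr => i _; rewrite !mxE.
Qed.

Lemma inner_sgrad3 Y u v j p : 0 < pgram_area (jacobian Y j p) ->
  inner (sgrad3 Y u j p) (sgrad3 Y v j p) =
  inner (frame_coef Y j p *m jacobian u j p) (frame_coef Y j p *m jacobian v j p).
Proof.
by move=> /tangent_frameP[TT _]; rewrite !sgrad3E inner_frame.
Qed.

Definition grad_density Y u v j p : R :=
  inner (sgrad3 Y u j p) (sgrad3 Y v j p) * pgram_area (jacobian Y j p).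

(** The density involves the chosen orthonormal frame, but it agrees with an
    expression in jacobians alone, whose entries are polynomial. *)
Lemma tame_grad_density Y u v j : positive_jacobian g Y ->
  tame T (grad_density Y u v j \o amap j).
Proof.
move=> Y0; pose J x := jacobian Y j (amap j x).
have J0 x : T x -> 0 < pgram_area (J x) by move=> Tx; apply: Y0; exists x.
apply: (@tame_eq _ _ (fun x => \tr (\adj (J x *m (J x)^T) *m
   (jacobian u j (amap j x) *m (jacobian v j (amap j x))^T)) / pgram_area (J x))).
  move=> x /set_mem/J0 Jx; rewrite /= /grad_density inner_sgrad3//.
  have [TT _] := tangent_frameP Jx.
  by rewrite (@inner_mulmx_gram _ _ (J x))//  frame_coefK.
have tJ w := tame_jacobian T w j.
apply: tameM; last exact: (tameV J0 (tame_pgram_area (tJ Y))).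
have tKL := tame_mulmx (tJ u) (tame_trmx (tJ v)).
have tadj := tame_adj2 (tame_mulmx (tJ Y) (tame_trmx (tJ Y))).
exact: tame_mxtrace (tame_mulmx tadj tKL).
Qed.

Lemma areaE v : area g v = surf_int (fun j p => pgram_area (jacobian v j p)).
Proof.
by apply: eq_surf_int => j p _; rewrite mul1r.
Qed.

Lemma area_diff_le l tau Y X : 0 < tau -> fe3 g l Y -> fe3 g l X ->
  positive_jacobian g Y ->
  area g X - area g Y <=
    tau * surf_dot_mx Y (@sgrad3 R g Y X)
            (@sgrad3 R g Y (fun p => tau^-1 *: (X p - Y p))).
Proof.
move=> tau0 fY fX Y0; rewrite -ler_pdivrMl// !areaE -surf_intZB; last 2 first.
- by move=> j; apply: tame_pgram_area; exact: tame_jacobian.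
- by move=> j; apply: tame_pgram_area; exact: tame_jacobian.
apply: le_surf_int => [j|j|j p Tp].
- apply: tameM; first exact: tame_cst.
  by apply: tameB; apply: tame_pgram_area; exact: tame_jacobian.
- exact: (@tame_grad_density Y X).
rewrite inner_sgrad3; last exact: Y0.
rewrite (jacobianZB _ fX fY)//.
have Jp : 0 < pgram_area (jacobian Y j p) by exact: Y0.
apply: area_change_le_inner => //.
by rewrite frame_coefK//; have [] := tangent_frameP Jp.
Qed.

Lemma eq_area u v : (forall p, polyhedron g p -> u p = v p) -> area g u = area g v.
Proof.
move=> uv; rewrite !areaE; apply: eq_surf_int => j p _; congr pgram_area.
apply/matrixP => i k; rewrite !mxE; apply: eq_tderiv => z Tz.
by rewrite uv//; exists j.
Qed.

Lemma eq_fe3 l u v : (forall p, polyhedron g p -> u p = v p) -> fe3 g l u -> fe3 g l v.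
Proof.
move=> uv fu k; have [cu pu] := fu k; split.
  by apply: subspace_eq_continuous cu => p /set_mem Sp; rewrite /from_subspace uv.
move=> j; have [q [dq qE]] := pu j; exists q; split => // p Tp.
by rewrite -qE// uv//; exists j.
Qed.

Lemma fe3ZB l c u v : fe3 g l u -> fe3 g l v -> fe3 g l (fun p => c *: (u p - v p)).
Proof.
move=> fu fv k; have [cu pu] := fu k; have [cv pv] := fv k; split.
  rewrite (_ : (fun p => _) = (fun p => c * (u p 0 k - v p 0 k))); last first.
    by apply/funext => p; rewrite !mxE.
  move=> p; apply: (@continuousM R (subspace (polyhedron g)) (fun=> c)
    (fun p => u p 0 k - v p 0 k)); first exact: cst_continuous.
  by apply: (@continuousB _ _ _ (fun p : subspace (polyhedron g) => u p 0 k) (fun p => v p 0 k));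
    [exact: cu | exact: cv].
move=> j; have [q [dq qE]] := pu j; have [r [dr rE]] := pv j.
exists (c *: (q - r)); split.
  move=> m /msuppZ_le/msuppB_le; rewrite mem_cat => /orP[]; [exact: dq | exact: dr].
by move=> p Tp; rewrite !mxE qE// rE// /poly_eval mevalZ mevalB.
Qed.

(** The test functions [H] and [(X - Y) / tau] cancel the coupling terms; with
    the factor [1 / tau] put into the test function, these are equal as
    integrals, by symmetry of the integrand. *)
Lemma scheme_step fl l tau Y X (H : 'rV[R]_3 -> R) : 0 < tau ->
  fe3 g l Y -> positive_jacobian g Y -> scheme_solution g fl l tau Y X H ->
  area g X <= area g Y - tau * flow_form g fl Y H H.
Proof.
move=> tau0 fY Y0 [fX fH eqH eqX].
have coupling : surf_dot_mx (g := g) Y (fun j p => H p *: unit_normal Y j p)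
    (fun _ p => tau^-1 *: (X p - Y p)) = flow_form g fl Y H H.
  by rewrite -(eqH H fH); apply: eq_surf_int => j p _; rewrite innerC.
have energy (a b f E : R) : a - b <= tau * E -> f + E = 0 -> a <= b - tau * f.
  by move=> ab /eqP; rewrite addr_eq0 => /eqP ->; rewrite mulrN opprK addrC -lerBlDr.
apply: energy (area_diff_le tau0 fY fX Y0) _.
by rewrite -coupling; exact: eqX (fe3ZB tau^-1 fX fY).
Qed.

End DiscreteSurface.

Unset Implicit Arguments.

Theorem theorem3p2 (R : realType) (g : grid R) (fl : flow) (l M : nat) (tau : R)
    (Y X : nat -> 'rV[R]_3 -> 'rV[R]_3) (H : nat -> 'rV[R]_3 -> R) :
  closed_oriented_polyhedral_surface g ->
  (1 <= l)%N ->
  0 < tau ->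
  fe3 g l (Y 0%N) ->
  (forall m, (m <= M)%N ->
     [/\ positive_jacobian g (Y m),
         scheme_solution g fl l tau (Y m) (X m.+1) (H m.+1) &
         forall p, polyhedron g p -> Y m.+1 p = X m.+1 p]) ->
  area g (Y M.+1) <=
    area g (Y 0%N) - tau * \sum_(0 <= m < M.+1) flow_form g fl (Y m) (H m.+1) (H m.+1).
Proof.
move=> [_ _ _ frame_lin _] _ tau0 fY0 step.
have key n : (n <= M.+1)%N -> fe3 g l (Y n) /\ area g (Y n) <=
    area g (Y 0%N) - tau * \sum_(0 <= m < n) flow_form g fl (Y m) (H m.+1) (H m.+1).
  elim: n => [_|n IH nM]; first by rewrite big_geq// mulr0 subr0.
  have [fY leY] := IH (ltnW nM).
  have [posY solX YX] := step n nM; split.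
    by have [fX _ _ _] := solX; apply: eq_fe3 fX => p Sp; rewrite YX.
  rewrite (eq_area YX) big_nat_recr//= mulrDr opprD addrA.
  apply: le_trans (scheme_step frame_lin tau0 fY posY solX) _.
  by rewrite lerB.
exact: (key M.+1 (leqnn _)).2.
Qed.
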